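(* Fix a positive integer $d$, an integer $k\ge0$ and a partition $\lambda\vdash k$ with $\ell(\lambda)$ parts, in which the part $i$ occurs $m_i$ times $(i\ge1)$. Then, as $n\to\infty$, the coefficient of $e_\lambda$ in the expansion of $c_k(n,d)$ in the elementary symmetric basis satisfies $$[e_\lambda]\,c_k(n,d)=\frac{1}{\prod_{i\ge1}m_i!\,\cdot\,((d-1)!)^{\ell(\lambda)}}\;n^{(d-1)\ell(\lambda)}+O\!\left(n^{(d-1)\ell(\lambda)-1}\right).$$
   Context: For integers $n\ge1$, $d\ge1$ let $A_{n,d}=\{\alpha\in\mathbb{Z}_{\ge0}^n:\alpha_1+\cdots+\alpha_n=d\}$. $c_k(n,d)$ is the homogeneous degree-$k$ part of $\prod_{\alpha\in A_{n,d}}(1+\alpha_1x_1+\cdots+\alpha_nx_n)$, a symmetric polynomial in $x_1,\ldots,x_n$ (the $k$-th Chern class of $\mathrm{Sym}^d$ of a rank-$n$ bundle with Chern roots $x_1,\ldots,x_n$). $e_i$ is the $i$-th elementary symmetric polynomial in $x_1,\ldots,x_n$ and $e_\lambda=\prod_ie_{\lambda_i}$. For $n\ge k$ the $e_\lambda$ with $\lambda\vdash k$ form a basis of the symmetric polynomials of degree $k$ over $\mathbb{Q}$, so the coefficient $[e_\lambda]c_k(n,d)$ is well defined.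
   Formalization: For d = 1 the formal theorem assumes λ has at most one part: since c_k(n,1) = e_k, the coefficient of e_λ is 0 whenever ℓ(λ) ≥ 2, so the stated formula (e.g. 1/2 + O(1/n) for λ = (1,1)) fails in exactly these excluded cases. *)

(* Defs.v *)
From mathcomp Require Import all_boot all_order perm all_algebra.
From mathcomp.multinomials Require Import mpoly.
From Stdlib Require Import ClassicalEpsilon.

Set Implicit Arguments.
Unset Strict Implicit.
Unset Printing Implicit Defensive.

Import Order.TTheory GRing.Theory Num.Theory.
Local Open Scope ring_scope.

(* The exponent vectors alpha with |alpha| = d are taken in the finite type of
   multinomials of degree < d.+1. *)
Definition chern_total (n d : nat) : {mpoly rat[n]} :=
  \prod_(alpha : 'X_{1..n < d.+1} | mdeg alpha == d)
     (1 + \sum_(i < n) (alpha i)%:R *: 'X_i).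

Definition chern (k n d : nat) : {mpoly rat[n]} :=
  pihomog (@mdeg n) k (chern_total n d).

Definition is_partn (k : nat) (la : seq nat) : bool :=
  [&& sorted geq la, 0%N \notin la & sumn la == k].

Definition mesym_prod (n : nat) (la : seq nat) : {mpoly rat[n]} :=
  \prod_(i <- la) mesym n rat i.

(* Partitions of k have at most k parts, all at most k, so they all occur,
   once each, among the bounded sequences k.-bseq 'I_k.+1 *)
Definition mesym_expansion (k n : nat) (p : {mpoly rat[n]}) (a : seq nat -> rat) :=
  p = \sum_(mu : k.-bseq 'I_k.+1 | is_partn k (map val mu))
         a (map val mu) *: mesym_prod n (map val mu).

(* [e_la] p, for p symmetric and homogeneous of degree k <= n: see
   mesym_coefP and mesym_coef_uniq below. *)
Definition mesym_coef (k n : nat) (la : seq nat) (p : {mpoly rat[n]}) : rat :=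
  epsilon (inhabits (fun=> 0)) (@mesym_expansion k n p) la.

Section MesymBasis.

Variables k n : nat.
Hypothesis lekn : (k <= n)%N.

Local Notation S := [tuple mesym n rat i.+1 | i < n].
Local Notation pbseq := (k.-bseq 'I_k.+1).

Let mult (la : seq nat) : 'X_{1..n} := [multinom count_mem i.+1 la | i < n].

Lemma partn_leq la i : is_partn k la -> i \in la -> (i <= k)%N.
Proof.
case/and3P=> _ _ /eqP <-; elim: la => //= j la ih.
rewrite inE => /orP[/eqP->|/ih le_i]; first exact: leq_addr.
exact: leq_trans le_i (leq_addl _ _).
Qed.

Lemma partn_size la : is_partn k la -> (size la <= k)%N.
Proof.
case/and3P=> _ + /eqP <-; elim: la => //= j la ih.
rewrite inE negb_or => /andP[j0 /ih le_s].
by rewrite -add1n leq_add // lt0n eq_sym.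
Qed.

Lemma partn_bseq la : is_partn k la -> {mu : pbseq | map val mu = la}.
Proof.
move=> hla; have le_s := partn_size hla.
have hs : (size (map (@inord k) la) <= k)%N by rewrite size_map.
exists (Bseq hs) => /=; rewrite -map_comp -[RHS]map_id; apply/eq_in_map => i hi.
by rewrite /= inordK // ltnS (partn_leq hla).
Qed.

Lemma big_partn (R : Type) (idx : R) (op : Monoid.com_law idx) la (F : nat -> R) :
  is_partn k la ->
  \big[op/idx]_(i <- la) F i =
  \big[op/idx]_(i < n) iterop (count_mem i.+1 la) op (F i.+1) idx.
Proof.
move=> hla; have le_la := partn_leq hla.
have n0 : 0%N \notin la by case/and3P: hla.
elim: la {hla} n0 le_la => [|j la ih] n0 le_la.
  by rewrite big_nil big1.
move: n0; rewrite inE negb_or => /andP[j0 n0].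
rewrite big_cons ih //; last by move=> i hi; apply: le_la; rewrite inE hi orbT.
case: j j0 le_la => [//|j] _ le_la.
have ltjn : (j < n)%N by apply: leq_trans lekn; apply: le_la; rewrite inE eqxx.
rewrite (bigD1 (Ordinal ltjn)) // [in RHS](bigD1 (Ordinal ltjn)) //= eqxx add1n Monoid.mulmA; congr (op _ _).
  by rewrite !Monoid.iteropE.
apply: eq_bigr => i /eqP ne_i; case: eqP => [[e]|_]; last by rewrite add0n.
by case: ne_i; apply: val_inj.
Qed.

Lemma mesym_prodE la : is_partn k la -> mesym_prod n la = 'X_[mult la] \mPo S.
Proof.
move=> hla; rewrite comp_mpolyX /mesym_prod (big_partn _ _ hla).
by apply: eq_bigr => i _; rewrite tnth_mktuple mnmE.
Qed.

Lemma mnmwgt_mult la : is_partn k la -> mnmwgt (mult la) = k.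
Proof.
move=> hla; have /and3P[_ _ /eqP <-] := hla.
rewrite sumnE (big_partn _ _ hla); apply: eq_bigr => i _; rewrite mnmE.
by rewrite Monoid.iteropE mulnC iter_addn_0.
Qed.

Lemma mult_inj la mu : is_partn k la -> is_partn k mu ->
  mult la = mult mu -> la = mu.
Proof.
move=> hla hmu /mnmP e.
have /and3P[sla la0 _] := hla; have /and3P[smu mu0 _] := hmu.
apply: (sorted_eq _ _ sla smu).
- by move=> x y z /= h1 h2; apply: leq_trans h2 h1.
- by move=> x y /andP[h1 h2]; apply/eqP; rewrite eqn_leq /geq /= in h1 h2 *; rewrite h1 h2.
apply/allP=> -[|i] _ /=.
  by rewrite (count_memPn la0) (count_memPn mu0).
case: (ltnP i n) => [ltin|leni].
  by have := e (Ordinal ltin); rewrite !mnmE => /= ->.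
have out nu : is_partn k nu -> count_mem i.+1 nu = 0%N.
  move=> hnu; apply/count_memPn/negP => /(partn_leq hnu) le_i.
  by have := leq_trans le_i lekn; rewrite ltnNge leni.
by rewrite !out.
Qed.

Lemma mult_surj (m : 'X_{1..n}) : mnmwgt m = k ->
  exists2 la, is_partn k la & mult la = m.
Proof.
move=> wm; pose s := flatten [seq nseq (m i) i.+1 | i <- enum 'I_n].
have cnt (a : pred nat) : count a s = (\sum_(i < n) a i.+1 * m i)%N.
  rewrite count_flatten sumnE 2!big_map big_enum /=.
  by apply: eq_bigr => i _; rewrite count_nseq.
exists (sort geq s).
  apply/and3P; split.
  - by apply: sort_sorted => x y; apply: leq_total.
  - by rewrite mem_sort; apply/count_memPn; rewrite cnt big1.
  - apply/eqP; rewrite -wm (perm_sumn (permEl (perm_sort _ _))).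
    rewrite /s sumn_flatten sumnE 2!big_map /mnmwgt big_enum /=.
    by apply: eq_bigr => i _; rewrite sumn_nseq mulnC.
apply/mnmP=> i; rewrite mnmE (seq.permP (permEl (perm_sort _ _))) cnt.
rewrite (bigD1 i) //= eqxx mul1n big1 ?addn0 // => j ne_ji.
by rewrite eqSS val_eqE (negbTE ne_ji).
Qed.

Let lift (a : seq nat -> rat) : {mpoly rat[n]} :=
  \sum_(mu : pbseq | is_partn k (map val mu)) a (map val mu) *: 'X_[mult (map val mu)].

Let liftP a : lift a \mPo S = \sum_(mu : pbseq | is_partn k (map val mu))
  a (map val mu) *: mesym_prod n (map val mu).
Proof.
rewrite linear_sum /=; apply: eq_bigr => mu hmu.
by rewrite linearZ /= mesym_prodE.
Qed.

Let mcoeff_lift a la : is_partn k la -> (lift a)@_(mult la) = a la.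
Proof.
move=> hla; have [mu emu] := partn_bseq hla.
rewrite /lift linear_sum (bigD1 mu) /= ?emu //.
rewrite mcoeffZ mcoeffX eqxx mulr1 big1 ?addr0 // => nu /andP[hnu ne].
rewrite mcoeffZ mcoeffX; case: eqP; rewrite ?mulr0 // => /(mult_inj hnu hla) e.
case/eqP: ne; apply/val_inj/(inj_map val_inj).
by rewrite /= e -emu.
Qed.

Lemma mesym_expansion_ex (p : {mpoly rat[n]}) :
  p \is symmetric -> p \is k.-homog -> exists a, mesym_expansion k p a.
Proof.
move=> sp hp; pose t := symf p; have pE : p = t \mPo S := symfP sp.
have ht : t \is k.-homog for (@mnmwgt n) by rewrite mwmwgt_homogE -pE.
pose a la := t@_(mult la).
exists a; rewrite /mesym_expansion -liftP {1}pE.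
congr (_ \mPo _); apply/mpolyP => m.
have [wm|wm] := eqVneq (mnmwgt m) k.
  by have [la hla <-] := mult_surj wm; rewrite mcoeff_lift.
rewrite (dhomog_nemf_coeff ht) // linear_sum big1 //= => mu hmu.
rewrite mcoeffZ mcoeffX; case: eqP; rewrite ?mulr0 // => e.
by move: wm; rewrite -e mnmwgt_mult ?eqxx.
Qed.

Lemma mesym_expansion_uniq (p : {mpoly rat[n]}) a b la :
  mesym_expansion k p a -> mesym_expansion k p b -> is_partn k la -> a la = b la.
Proof.
rewrite /mesym_expansion -!liftP => -> /msym_fundamental_un e hla.
by rewrite -(mcoeff_lift a hla) e mcoeff_lift.
Qed.

Lemma mesym_coefP (p : {mpoly rat[n]}) : p \is symmetric -> p \is k.-homog ->
  mesym_expansion k p (fun la => mesym_coef k la p).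
Proof.
by move=> sp hp; exact: (epsilon_spec _ _ (mesym_expansion_ex sp hp)).
Qed.

Lemma mesym_coef_uniq (p : {mpoly rat[n]}) a la :
  mesym_expansion k p a -> is_partn k la -> mesym_coef k la p = a la.
Proof.
move=> ea hla; apply: (mesym_expansion_uniq _ ea hla).
exact: (epsilon_spec _ (mesym_expansion k p) (ex_intro _ a ea)).
Qed.

End MesymBasis.

Lemma chern_homog k n d : chern k n d \is k.-homog.
Proof. exact: pihomogP. Qed.

Lemma chern_sym k n d : chern k n d \is symmetric.
Proof.
apply/pihomog_sym/issymP => s; rewrite /chern_total rmorph_prod /=.
pose m_s (al : 'X_{1..n}) : 'X_{1..n} := [multinom al (s i) | i < n].
have mdeg_s al : mdeg (m_s al) = mdeg al by rewrite mdeg_mperm.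
have lt_s (al : 'X_{1..n < d.+1}) : (mdeg (m_s al) < d.+1)%N.
  by rewrite mdeg_s bmdeg.
pose f al := BMultinom (lt_s al).
have f_inj : injective f.
  by move=> a b /(congr1 (fun m => bmnm m)) /mperm_inj /val_inj.
rewrite (reindex_inj f_inj) /=; apply: eq_big => [al|al _]; first by rewrite mdeg_s.
rewrite rmorphD rmorph1 rmorph_sum /=; congr (1 + _).
rewrite [RHS](reindex_inj (@perm_inj _ s)) /=; apply: eq_bigr => i _.
rewrite linearZ /= mnmE msymX; congr (_ *: 'X_[_]).
by apply/mnmP => j; rewrite !mnmE (canF_eq (permK s)) eq_sym.
Qed.

Lemma chern_total1 n : chern_total n 1 = \prod_(i < n) (1 + 'X_i).
Proof.
rewrite /chern_total.
have lt1 (i : 'I_n) : (mdeg U_(i)%MM < 2)%N by rewrite mdeg1.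
pose f i := BMultinom (lt1 i).
transitivity (\prod_(al in [set f i | i : 'I_n])
   (1 + \sum_(i < n) (bmnm al i)%:R *: ('X_i : {mpoly rat[n]}))).
  apply: eq_bigl => al; apply/idP/imsetP => [|[i _ ->]]; last by rewrite /= mdeg1.
  by rewrite mdeg_eq1 => /existsP[i /eqP e]; exists i => //; apply: val_inj.
rewrite big_imset /=; last first.
  move=> i j _ _ /(congr1 (fun m => bmnm m)) /= /mnmP/(_ i).
  by rewrite !mnm1E eqxx; case: eqP.
apply: eq_bigr => i _; rewrite (bigD1 i) //= mnm1E eqxx scale1r.
by rewrite big1 ?addr0 // => j ne; rewrite mnm1E eq_sym (negbTE ne) scale0r.
Qed.

Lemma chern1 k n : chern k n 1 = mesym n rat k.
Proof.
rewrite /chern chern_total1 bigA_distr linear_sum /= /mesym big_mkcond [RHS]big_mkcond /=.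
rewrite (reindex_inj (inv_inj (@setCK _))) /=.
apply: eq_bigr => h _.
rewrite (_ : \prod_i _ = \prod_(i in h) 'X_i); last first.
  by rewrite [RHS]big_mkcond; apply: eq_bigr => i _; rewrite inE; case: (i \in h).
rewrite (_ : \prod_(i in h) 'X_i = 'X_[\sum_(i in h) U_(i)]); last first.
  by apply/esym/(big_morph (fun m => 'X_[m])); [move=> x y; exact: mpolyXD | exact: mpolyX0].
have hm : mdeg (\sum_(i in h) U_(i))%MM = #|h|.
  by rewrite mdeg_sum (eq_bigr (fun=> 1%N)) ?sum1_card // => i _; rewrite mdeg1.
by rewrite pihomogX /= hm.
Qed.

(* Hence, for d = 1, [e_la] c_k(n,1) is 0 as soon as la has at least two parts,
   whereas the leading term (\prod_i m_i!)^-1 n^0 does not vanish: the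
   asymptotic formula needs d >= 2 or at most one part. *)
Lemma mesym_coef11_chern1 n : (1 < n)%N -> mesym_coef 2 [:: 1; 1]%N (chern 2 n 1) = 0.
Proof.
move=> n1; rewrite chern1.
have p2 : is_partn 2 [:: 2]%N by [].
have ex : mesym_expansion 2 (mesym n rat 2) (fun la => (la == [:: 2]%N)%:R).
  rewrite /mesym_expansion; have [mu emu] := partn_bseq p2.
  rewrite (bigD1 mu) /= ?emu // eqxx scale1r big1 ?addr0.
    by rewrite /mesym_prod big_seq1.
  move=> nu /andP[_ ne]; case: eqP; rewrite ?scale0r // => e.
  case/eqP: ne; apply/val_inj/(inj_map val_inj).
  by rewrite /= e -emu.
by rewrite (mesym_coef_uniq n1 ex).
Qed.

(* Main.v *)
Require Import Defs.
From mathcomp Require Import all_boot all_order all_algebra.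
From mathcomp Require Import ring.
From mathcomp.multinomials Require Import mpoly.

(* Setting x_i = 0 for i >= K = k keeps the coefficient of e_lambda and turns
   c_k(n,d) into an elementary symmetric function of linear forms in K fixed
   variables.  Its j-th power sum is the sum over 1 <= e <= d of N(n - K, d - e)
   times a fixed symmetric polynomial, where N(m, f) counts the monomials of
   degree f in m variables, so it is n^(d-1)/(d-1)! times the ordinary power sum
   x_1^j + ... + x_K^j, up to lower order in n.  Write everything as a
   polynomial in y_i = e_(i+1) and rescale each y_i by n^(d-1): for d >= 2 only
   the linear part (-1)^(j-1) j e_j of the power sum survives, up to the
   factor 1/(d-1)!.  Newton's identity k c_k = sum_j (-1)^(j-1) p_j c_(k-j) then
   passes to the limit, and its limit is the recurrence satisfied by the weight k
   part of exp((y_0 + ... + y_(K-1)) / (d-1)!).  For d = 1, c_k = e_k. *)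

Import Order.TTheory GRing.Theory Num.Theory.
Local Open Scope ring_scope.

Set Implicit Arguments.
Unset Strict Implicit.
Unset Printing Implicit Defensive.

(** * Newton's identities for a finite list of ring elements *)

Section Newton.

Variable R : comNzRingType.
Implicit Types (s : seq R) (x : R).

Definition newton_rec (p c : nat -> R) :=
  forall k, k.+1%:R * c k.+1 = \sum_(j < k.+1) (-1) ^+ j * p j.+1 * c (k - j)%N.

(** The generating polynomial of the elementary symmetric functions of [s], the [k]-th being its
    [k]-th coefficient. *)
Definition esym_poly s : {poly R} := \prod_(x <- s) (1 + x *: 'X).

Definition psum s j : R := \sum_(x <- s) x ^+ j.

Lemma coef_mul1DZX x (p : {poly R}) k :
  ((1 + x *: 'X) * p)`_k = p`_k + x * (if k is k'.+1 then p`_k' else 0).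
Proof. by rewrite mulrDl mul1r -scalerAl coefD coefZ coefXM; case: k. Qed.

(** In power series: the alternating sum of the [x^(j+1) T^j] is [x / (1 + x T)], which cancels the
    factor [1 + x T] and leaves [x p]. *)
Lemma sum_alt_coef_mul1DZX x (p : {poly R}) k :
  \sum_(j < k.+1) (-1) ^+ j * x ^+ j.+1 * ((1 + x *: 'X) * p)`_(k - j)
  = x * p`_k.
Proof.
elim: k => [|k ih].
  by rewrite big_ord1 subnn coef_mul1DZX mulr0 addr0 expr0 mul1r expr1.
rewrite big_ord_recl subn0 expr0 mul1r expr1.
under eq_bigr => j _ do
  rewrite lift0 subSS exprS [x ^+ _]exprS mulrACA mulN1r -mulrA.
rewrite -mulr_sumr ih coef_mul1DZX; move: (p`_k.+1) (p`_k) => u v; ring.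
Qed.

Lemma coef_esym_poly0 s : (esym_poly s)`_0 = 1.
Proof.
rewrite /esym_poly; elim: s => [|x s ih]; first by rewrite big_nil coef1.
by rewrite big_cons coef_mul1DZX ih mulr0 addr0.
Qed.

(** Induction on the list: the new powers of [x] contribute [x p_k] by the previous lemma, and the
    old power sums contribute through the induction hypothesis at two consecutive indices. *)
Lemma newton_esym s : newton_rec (psum s) (fun k => (esym_poly s)`_k).
Proof.
rewrite /newton_rec /esym_poly /psum; elim: s => [|x s ih] k.
  rewrite big_nil coef1 mulr0 big1 // => j _.
  by rewrite big_nil mulr0 mul0r.
rewrite big_cons; set p := \prod_(j <- s) _ in ih *.
under eq_bigr => j _ do rewrite big_cons mulrDr mulrDl.
rewrite big_split /= sum_alt_coef_mul1DZX.
under eq_bigr => j _ do rewrite coef_mul1DZX mulrDr.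
rewrite big_split /= -ih coef_mul1DZX.
case: k => [|k].
  by rewrite big_ord1 subnn !mulr0 !addr0 !mul1r addrC.
(* In the last summand [k - j = 0], where the shifted coefficient takes its default value 0. *)
rewrite [X in _ = _ + (_ + X)]big_ord_recr /= subnn mulr0 mulr0 addr0.
rewrite (_ : \sum_(j < k.+1) _ = x * (k.+1%:R * p`_k.+1)); last first.
  rewrite ih mulr_sumr; apply: eq_bigr => j _.
  by rewrite subSn -1?ltnS // mulrCA.
rewrite -[k.+2%:R]natr1.
by move: (p`_k.+2) (p`_k.+1) => u v; ring.
Qed.

End Newton.

(** * Calculus of leading terms in [n = K + m] *)

Section Asymptotics.

Variable K : nat.
Implicit Types (f g : nat -> rat) (a b : rat) (e : nat).

(* The leading behaviour [f = a n^e + O(n^(e-1))] at [n = K + m], the error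
   bound being multiplied by [n] to cover [e = 0]. *)
Definition asy e a f := exists C : rat, exists N : nat, forall m, (N <= m)%N ->
  (K + m)%:R * `|f m - a * (K + m)%:R ^+ e| <= C * (K + m)%:R ^+ e.

Lemma asyP e a f : asy e a f -> exists C : rat, exists N : nat,
  forall m, (N <= m)%N -> [/\ 0 <= C, 1 <= (K + m)%:R :> rat &
  (K + m)%:R * `|f m - a * (K + m)%:R ^+ e| <= C * (K + m)%:R ^+ e].
Proof.
case=> C [N h]; exists `|C|, N.+1 => m lt_m.
have n1 : 1 <= (K + m)%:R :> rat.
  by rewrite ler1n (leq_trans _ (leq_addl _ _)) // (leq_trans _ lt_m).
split=> //; apply: le_trans (h m (ltnW lt_m)) _.
by rewrite ler_wpM2r ?ler_norm // exprn_ge0 // (le_trans ler01).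
Qed.

Lemma eq_asy e a b f g : a = b -> f =1 g -> asy e a f -> asy e b g.
Proof.
by move=> <- fg [C [N h]]; exists C, N => m /h; rewrite fg.
Qed.

Lemma asy_cst a : asy 0 a (fun=> a).
Proof.
by exists 0, 0%N => m _; rewrite expr0 mulr1 subrr normr0 mulr0 mul0r.
Qed.

Lemma asy0 e : asy e 0 (fun=> 0).
Proof. by exists 0, 0%N => m _; rewrite !mul0r subrr normr0 mulr0. Qed.

Lemma asyD e a b f g : asy e a f -> asy e b g ->
  asy e (a + b) (fun m => f m + g m).
Proof.
case=> C [N h] [C' [N' h']]; exists (C + C'), (maxn N N') => m.
rewrite geq_max => /andP[/h {}h /h' {}h']; rewrite !mulrDl.
apply: le_trans (lerD h h'); rewrite -mulrDr ler_wpM2l ?ler0n //.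
by rewrite opprD addrACA ler_normD.
Qed.

(** With errors [u] and [v], the error of the product is [u v + u b n^e' + a n^e v]. In the first
    term only one factor [n] is spent, on [u], while [|v| <= C' n^e'] because [n >= 1]. *)
Lemma asyM e e' a b f g : asy e a f -> asy e' b g ->
  asy (e + e') (a * b) (fun m => f m * g m).
Proof.
move=> /asyP[C [N h]] /asyP[C' [N' h']].
exists (C * C' + C * `|b| + `|a| * C'), (maxn N N') => m.
rewrite geq_max => /andP[/h[C0 n1 {}h] /h'[C'0 _ {}h']].
move: ((K + m)%:R : rat) n1 h h' => n n1 h h'.
have n0 : 0 <= n by apply: le_trans n1.
have ne0 := exprn_ge0 e n0; have ne'0 := exprn_ge0 e' n0.
pose u := f m - a * n ^+ e; pose v := g m - b * n ^+ e'.
have v_le : `|v| <= C' * n ^+ e'.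
  by apply: le_trans h'; rewrite -[leLHS]mul1r ler_wpM2r.
rewrite -/u in h; rewrite -/v in h'.
have -> : f m * g m - a * b * n ^+ (e + e')
    = u * v + u * b * n ^+ e' + a * n ^+ e * v.
  by rewrite exprD /u /v; ring.
apply: le_trans (_ : n * (`|u| * `|v| + `|u| * `|b| * n ^+ e'
                          + `|a| * n ^+ e * `|v|) <= _).
  rewrite ler_wpM2l //; do 2?[apply: le_trans (ler_normD _ _) _; apply: lerD];
    by rewrite !normrM ?(ger0_norm ne0) ?(ger0_norm ne'0).
rewrite !mulrDr !mulrDl exprD.
apply: lerD; first apply: lerD.
- by rewrite [leLHS]mulrA [leRHS]mulrACA ler_pM // mulr_ge0.
- rewrite [leRHS](_ : _ = C * n ^+ e * (n ^+ e' * `|b|)); last by ring.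
  rewrite [leLHS](_ : _ = n * `|u| * (n ^+ e' * `|b|)); last by ring.
  by rewrite ler_wpM2r // mulr_ge0.
- rewrite [leRHS](_ : _ = C' * n ^+ e' * (n ^+ e * `|a|)); last by ring.
  rewrite [leLHS](_ : _ = n * `|v| * (n ^+ e * `|a|)); last by ring.
  by rewrite ler_wpM2r // mulr_ge0.
Qed.

Lemma asyZ e a b f : asy e a f -> asy e (b * a) (fun m => b * f m).
Proof. exact: asyM (asy_cst b). Qed.

Lemma asy_sum (I : Type) (r : seq I) (P : pred I) e (a : I -> rat)
    (f : I -> nat -> rat) :
  (forall i, P i -> asy e (a i) (f i)) ->
  asy e (\sum_(i <- r | P i) a i) (fun m => \sum_(i <- r | P i) f i m).
Proof.
move=> h; elim: r => [|i r ih].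
  by apply: eq_asy (asy0 e) => [|m]; rewrite big_nil.
case Pi: (P i); last by apply: eq_asy ih => [|m]; rewrite big_cons Pi.
by apply: eq_asy (asyD (h _ Pi) ih) => [|m]; rewrite big_cons Pi.
Qed.

Lemma asy_lt e e' a f : (e < e')%N -> asy e a f -> asy e' 0 f.
Proof.
move=> lt_e /asyP[C [N h]]; exists (C + `|a|), N => m /h[C0 n1 {}h].
move: ((K + m)%:R : rat) n1 h => n n1 h.
have n0 : 0 <= n by apply: le_trans n1.
have ne0 := exprn_ge0 e n0; rewrite mul0r subr0.
apply: le_trans (_ : (C + `|a|) * n ^+ e.+1 <= _); last first.
  by rewrite ler_wpM2l ?addr_ge0 // ler_weXn2l.
rewrite -[f m](subrK (a * n ^+ e)).
apply: le_trans (ler_wpM2l n0 (ler_normD _ _)) _.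
rewrite mulrDr mulrDl lerD //.
  apply: le_trans h _; rewrite ler_wpM2l // ler_weXn2l //.
by rewrite normrM (ger0_norm ne0) exprS [leRHS]mulrCA.
Qed.

(** The falling factorial is a product of [e] factors, each [n] plus a constant; dividing by [e!]
    gives the binomial. *)
Lemma asy_bin e : asy e e`!%:R^-1 (fun m => 'C(e + m.-1, e)%:R).
Proof.
have lin (c : rat) : asy 1 1 (fun m => (K + m)%:R + c).
  exists `|c|, 0%N => m _; by rewrite mul1r expr1 addrC addKr mulrC.
have ffact_asy i : (i <= e)%N -> asy i 1 (fun m => ((e + m.-1) ^_ i)%:R).
  elim: i => [|i ih] lt_i; first exact: asy_cst.
  (* The next factor [e + (m - 1) - i] equals [(K + m) + (e - i - 1 - K)]; the threshold 1 avoids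
     [m = 0], where [m.-1] truncates. *)
  have [C [N h]] := asyM (ih (ltnW lt_i)) (lin (e%:R - i%:R - 1 - K%:R)).
  exists C, (maxn N 1) => -[|m]; first by rewrite geq_max andbF.
  rewrite geq_max => /andP[/h]; rewrite addn1 mulr1 => {}h _.
  rewrite ffactnSr natrM natrB; last by rewrite (leq_trans (ltnW lt_i)) ?leq_addr.
  rewrite (_ : _ - i%:R = (K + m.+1)%:R + (e%:R - i%:R - 1 - K%:R)) //=.
  by rewrite !natrD -natr1; ring.
apply: eq_asy (asyZ e`!%:R^-1 (ffact_asy e (leqnn e))) => [|m].
  by rewrite mulr1.
by rewrite -bin_ffact natrM mulrC mulfK // pnatr_eq0 -lt0n fact_gt0.
Qed.

End Asymptotics.

(** * Exponent vectors of given degree, and their splitting into [K] and [m] entries *)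

Section Multinomials.

Implicit Types (n d e : nat).

(** A list rather than a bounded type, because the length of this enumeration is a known binomial
    coefficient; [big_mnms] makes the link with [chern_total]. *)
Definition mnms n d : seq 'X_{1..n} :=
  [seq s2m (val t) | t : d.-tuple 'I_n <- enum (basis n d)].

Lemma mem_mnms n d (al : 'X_{1..n}) : (al \in mnms n d) = (mdeg al == d).
Proof. by rewrite basis_cover. Qed.

Lemma uniq_mnms n d : uniq (mnms n d).
Proof. exact: uniq_basis. Qed.

Lemma size_mnms n d : (0 < n)%N -> size (mnms n d) = 'C(d + n.-1, d).
Proof. by case: n => // n _; rewrite size_basis. Qed.

Lemma big_mnms (R : Type) (idx : R) (op : Monoid.com_law idx) n d F :
  \big[op/idx]_(al : 'X_{1..n < d.+1} | mdeg al == d) F (bmnm al) =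
  \big[op/idx]_(al <- mnms n d) F al.
Proof.
rewrite big_mkcond /= -(big_map (fun al : 'X_{1..n < d.+1} => bmnm al) predT
  (fun al => if mdeg al == d then F al else idx)) -big_mkcond -big_filter.
apply: perm_big; apply: uniq_perm; rewrite ?uniq_mnms ?filter_uniq //.
  by rewrite map_inj_uniq ?index_enum_uniq //; apply: val_inj.
move=> al; rewrite mem_filter mem_mnms; case: eqP => //= e.
have lt_al : (mdeg al < d.+1)%N by rewrite e.
by apply/mapP; exists (BMultinom lt_al); rewrite ?mem_index_enum.
Qed.

Section Split.

Variables K m : nat.

Definition lmnm (al : 'X_{1..K + m}) : 'X_{1..K} :=
  [multinom al (lshift m i) | i < K].

Definition rmnm (al : 'X_{1..K + m}) : 'X_{1..m} :=
  [multinom al (rshift K i) | i < m].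

Definition catmnm (be : 'X_{1..K}) (ga : 'X_{1..m}) : 'X_{1..K + m} :=
  [multinom match split i with inl j => be j | inr j => ga j end | i < K + m].

Lemma lmnmK be ga : lmnm (catmnm be ga) = be.
Proof.
apply/mnmP => i; rewrite !mnmE.
by rewrite (_ : split _ = inl i) // -[lshift m i]/(unsplit (inl i)) unsplitK.
Qed.

Lemma rmnmK be ga : rmnm (catmnm be ga) = ga.
Proof.
apply/mnmP => i; rewrite !mnmE.
by rewrite (_ : split _ = inr i) // -[rshift K i]/(unsplit (inr i)) unsplitK.
Qed.

Lemma catmnmK al : catmnm (lmnm al) (rmnm al) = al.
Proof.
apply/mnmP => i; rewrite mnmE -[in RHS](splitK i).
by case: (split i) => j; rewrite mnmE.
Qed.

Lemma mdeg_catmnm be ga : mdeg (catmnm be ga) = (mdeg be + mdeg ga)%N.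
Proof.
rewrite !mdegE big_split_ord /=; congr (_ + _)%N; apply: eq_bigr => i _.
  by have /mnmP/(_ i) := lmnmK be ga; rewrite mnmE.
by have /mnmP/(_ i) := rmnmK be ga; rewrite mnmE.
Qed.

Lemma perm_fiber_lmnm d e be : mdeg be = e -> (e <= d)%N ->
  perm_eq [seq al <- mnms (K + m) d | be == lmnm al]
          [seq catmnm be ga | ga <- mnms m (d - e)].
Proof.
move=> deg_be le_ed; apply: uniq_perm.
- by rewrite filter_uniq ?uniq_mnms.
- by rewrite map_inj_uniq ?uniq_mnms // => x y /(congr1 rmnm); rewrite !rmnmK.
move=> al; rewrite mem_filter mem_mnms; apply/andP/mapP => [[/eqP be_al]|[ga]].
  rewrite -{1}(catmnmK al) mdeg_catmnm -be_al deg_be => /eqP <-.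
  exists (rmnm al); last by rewrite be_al catmnmK.
  by rewrite mem_mnms addKn.
rewrite mem_mnms => /eqP deg_ga ->.
by rewrite lmnmK eqxx mdeg_catmnm deg_be deg_ga subnKC.
Qed.

(** Exponent vectors are grouped by their first [K] entries [be]; the fiber over [be] depends only
    on its degree [e], the other entries forming any vector of degree [d - e]. *)
Lemma sum_lmnm (V : nmodType) d (F : 'X_{1..K} -> V) :
  \sum_(al <- mnms (K + m) d) F (lmnm al) =
  \sum_(e < d.+1) (\sum_(be <- mnms K e) F be) *+ size (mnms m (d - e)).
Proof.
transitivity (\sum_(e < d.+1) \sum_(al <- mnms (K + m) d)
    \sum_(be <- mnms K e | be == lmnm al) F be); last first.
  apply: eq_bigr => e _; rewrite -sumrMnl.
  under eq_bigr do rewrite big_mkcond.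
  rewrite exchange_big /= big_seq [RHS]big_seq.
  apply: eq_bigr => be; rewrite mem_mnms => /eqP deg_be.
  have le_ed : (e <= d)%N by rewrite -ltnS.
  have /perm_size := perm_fiber_lmnm deg_be le_ed.
  rewrite size_map => <-; rewrite -big_mkcond big_const_seq iter_addr_0.
  by rewrite size_filter.
rewrite exchange_big /= big_seq [RHS]big_seq.
apply: eq_bigr => al; rewrite mem_mnms => /eqP deg_al.
have lt_al : (mdeg (lmnm al) < d.+1)%N.
  by rewrite ltnS -deg_al -{2}(catmnmK al) mdeg_catmnm leq_addr.
rewrite (bigD1 (Ordinal lt_al)) //= [X in _ + X]big1 ?addr0.
  rewrite -big_filter (_ : filter _ _ = [:: lmnm al]) ?big_seq1 //.
  rewrite -(filter_pred1_uniq (uniq_mnms K (mdeg (lmnm al)))) ?mem_mnms //.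
move=> e ne_e; rewrite big_seq_cond big1 // => be; rewrite mem_mnms.
case/andP=> /eqP deg_be /eqP be_al; case/eqP: ne_e; apply: val_inj.
by rewrite /= -be_al.
Qed.

End Split.

End Multinomials.

(** * Chern classes as elementary symmetric functions of linear forms *)

Section Chern.

Implicit Types (n d k j : nat).

Definition lform n (al : 'X_{1..n}) : {mpoly rat[n]} :=
  \sum_(i < n) (al i)%:R *: 'X_i.

Lemma lform0 n : lform (0%MM : 'X_{1..n}) = 0.
Proof. by rewrite /lform big1 // => i _; rewrite mnm0E scale0r. Qed.

Lemma dhomog_lform n (al : 'X_{1..n}) : lform al \is 1.-homog.
Proof.
apply: rpred_sum => i _; apply: rpredZ.
by rewrite dhomogX /= mdeg1.
Qed.

Lemma coef_esym_poly_homog n (s : seq {mpoly rat[n]}) k :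
  {in s, forall x, x \is 1.-homog} -> (esym_poly s)`_k \is k.-homog.
Proof.
elim: s k => [|x s ih] k s1; rewrite /esym_poly.
  by rewrite big_nil coef1; case: k => [|k]; rewrite ?dhomog1 ?dhomog0.
have {}ih i : (esym_poly s)`_i \is i.-homog.
  by apply: ih => y y_s; apply: s1; rewrite inE y_s orbT.
rewrite big_cons coef_mul1DZX; apply: rpredD; first exact: ih.
case: k => [|k]; first by rewrite mulr0 dhomog0.
by rewrite -add1n; apply: dhomogM (ih k); apply: s1; rewrite inE eqxx.
Qed.

(** A formal variable marks the degree: the forms have degree 1, so the [k]-th coefficient of
    [esym_poly] is homogeneous of degree [k], and the value at 1 is [chern_total]. *)
Lemma chern_esym k n d :
  chern k n d = (esym_poly [seq lform al | al <- mnms n d])`_k.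
Proof.
set p := esym_poly _.
have hp i : p`_i \is i.-homog.
  by apply: coef_esym_poly_homog => _ /mapP[al _ ->]; apply: dhomog_lform.
have -> : chern k n d = pihomog (@mdeg n) k p.[1].
  rewrite /chern /chern_total /p /esym_poly big_map horner_prod.
  rewrite (big_mnms _ _ (fun al : 'X_{1..n} => 1 + \sum_(i < n) (al i)%:R *: 'X_i)).
  by congr (pihomog _ _ _); apply: eq_bigr => al _; rewrite !hornerE.
(* The range is widened so that it contains [k] even beyond the degree of [p]. *)
rewrite (@horner_coef_wide _ (maxn (size p) k.+1)) ?leq_maxl // linear_sum /=.
have lt_k : (k < maxn (size p) k.+1)%N by rewrite leq_max ltnSn orbT.
rewrite (bigD1 (Ordinal lt_k)) //= big1 ?addr0 => [|i ne_i].
  by rewrite expr1n mulr1 pihomog_dE.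
by rewrite expr1n mulr1 (pihomog_ne0 _ (hp i)).
Qed.

End Chern.

(** * Symmetry and uniqueness through Newton's recurrence *)

Section NewtonSymmetric.

Variables (n : nat) (p c : nat -> {mpoly rat[n]}).
Hypotheses (c0 : c 0 = 1) (newton : newton_rec p c).

Lemma newton_rec_c_sym : (forall j, p j.+1 \is symmetric) ->
  forall k, c k \is symmetric.
Proof.
move=> p_sym; elim/ltn_ind => -[_|k ih]; first by rewrite c0 rpred1.
have -> : c k.+1 = k.+1%:R^-1 *: (k.+1%:R * c k.+1).
  by rewrite mulr_natl -scaler_nat scalerA mulVf ?scale1r ?pnatr_eq0.
apply: rpredZ; rewrite newton; apply: rpred_sum => j _.
by rewrite rpredM ?rpredMsign ?p_sym // ih // ltnS leq_subr.
Qed.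

Lemma newton_rec_p_sym : (forall k, c k \is symmetric) ->
  forall j, p j.+1 \is symmetric.
Proof.
move=> c_sym; elim/ltn_ind => k ih.
have -> : p k.+1 = (-1) ^+ k *
    (k.+1%:R * c k.+1 - \sum_(j < k) (-1) ^+ j * p j.+1 * c (k - j)%N).
  rewrite newton big_ord_recr /= subnn c0 mulr1 addrAC subrr add0r.
  by rewrite signrMK.
rewrite rpredMsign rpredB ?rpredM ?rpred_nat //; apply: rpred_sum => j _.
by rewrite rpredM ?rpredMsign ?ih.
Qed.

End NewtonSymmetric.

Lemma newton_rec_inj n (p c c' : nat -> {mpoly rat[n]}) :
  c 0 = c' 0 -> newton_rec p c -> newton_rec p c' -> c =1 c'.
Proof.
move=> e0 nc nc'; elim/ltn_ind => -[_|k ih] //.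
apply: (@mulfI _ (k.+1%:R : {mpoly rat[n]})).
  by rewrite -[_%:R]scaler_nat scaler_eq0 oner_eq0 pnatr_eq0.
rewrite nc nc'; apply: eq_bigr => j _; rewrite ih //.
by rewrite ltnS leq_subr.
Qed.

Lemma map_esym_poly (R S : comNzRingType) (f : {rmorphism R -> S}) (s : seq R) :
  map_poly f (esym_poly s) = esym_poly (map f s).
Proof.
rewrite /esym_poly big_map rmorph_prod; apply: eq_bigr => x _.
by rewrite rmorphD rmorph1 /= map_polyZ /= map_polyX.
Qed.

Lemma psum_lmnm (R : comNzRingType) K m d j (F : 'X_{1..K} -> R) :
  psum [seq F (lmnm al) | al <- mnms (K + m) d] j =
  \sum_(e < d.+1) psum [seq F be | be <- mnms K e] j *+ size (mnms m (d - e)).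
Proof.
rewrite /psum big_map (sum_lmnm _ _ (fun be => F be ^+ j)).
by apply: eq_bigr => e _; rewrite [in RHS]big_map.
Qed.

(** * Setting the last [m] variables to zero *)

Section Restriction.

Variables K m : nat.

Definition restr_vars : (K + m).-tuple {mpoly rat[K]} :=
  [tuple match split i with inl j => 'X_j | inr _ => 0 end | i < K + m].

Definition rlforms d : seq {mpoly rat[K]} :=
  [seq lform (lmnm al) | al <- mnms (K + m) d].

Lemma restr_lform (al : 'X_{1..K + m}) :
  lform al \mPo restr_vars = lform (lmnm al).
Proof.
rewrite /lform linear_sum big_split_ord /= [X in _ + X]big1 ?addr0 => [|i _].
  apply: eq_bigr => i _; rewrite linearZ /= comp_mpolyXU -tnth_nth mnmE.
  rewrite tnth_mktuple (_ : split _ = inl i) //.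
  by rewrite -[lshift m i]/(unsplit (inl i)) unsplitK.
rewrite linearZ /= comp_mpolyXU -tnth_nth tnth_mktuple.
rewrite (_ : split _ = inr i) ?scaler0 //.
by rewrite -[rshift K i]/(unsplit (inr i)) unsplitK.
Qed.

Lemma restr_chern k d :
  chern k (K + m) d \mPo restr_vars = (esym_poly (rlforms d))`_k.
Proof.
rewrite chern_esym -coef_map /= map_esym_poly /rlforms -map_comp.
congr ((esym_poly _)`_k); apply: eq_map => al /=; exact: restr_lform.
Qed.

Lemma psum_rlforms d j : psum (rlforms d) j =
  \sum_(e < d.+1) psum [seq lform be | be <- mnms K e] j *+ size (mnms m (d - e)).
Proof. exact: psum_lmnm. Qed.

Lemma mnms_deg0 n : mnms n 0 = [:: 0%MM].
Proof.
apply/perm_small_eq => //; apply: uniq_perm; rewrite ?uniq_mnms // => al.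
by rewrite mem_mnms mdeg_eq0 inE.
Qed.

Lemma psum_deg0 n j : psum [seq lform be | be <- mnms n 0] j.+1 = 0.
Proof. by rewrite mnms_deg0 /psum /= big_seq1 lform0 expr0n. Qed.

(** Both sides are Chern classes at [d = 1]; forms that restrict to 0 do not change power sums of
    positive index, and these determine the coefficients by Newton's recurrence. *)
Lemma restr_mesym k : mesym (K + m) rat k \mPo restr_vars = mesym K rat k.
Proof.
rewrite -!chern1 restr_chern chern_esym; apply: newton_rec_inj (newton_esym _) _ k.
  by rewrite !coef_esym_poly0.
move=> k; rewrite newton_esym; apply: eq_bigr => j _.
rewrite psum_rlforms big_ord_recl big_ord1 psum_deg0 mul0rn add0r.
by rewrite mnms_deg0.
Qed.

(** The expansion in [K + m] variables restricts term by term, and [k <= K] keeps expansions unique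
    in [K] variables. *)
Lemma mesym_coef_restr k d la : (k <= K)%N -> is_partn k la ->
  mesym_coef k la (chern k (K + m) d) =
  mesym_coef k la (esym_poly (rlforms d))`_k.
Proof.
move=> le_kK la_partn; symmetry; apply: mesym_coef_uniq => //.
have le_kn : (k <= K + m)%N by apply: leq_trans le_kK (leq_addr _ _).
have := mesym_coefP le_kn (chern_sym k (K + m) d) (chern_homog k (K + m) d).
rewrite /mesym_expansion -restr_chern => {1}->.
rewrite linear_sum /=; apply: eq_bigr => mu _; rewrite linearZ /=.
congr (_ *: _); rewrite /mesym_prod rmorph_prod /=.
by apply: eq_bigr => i _; rewrite restr_mesym.
Qed.

Lemma rlforms_homog d k : (esym_poly (rlforms d))`_k \is k.-homog.
Proof.
by apply: coef_esym_poly_homog => _ /mapP[al _ ->]; apply: dhomog_lform.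
Qed.

Lemma psum_sym n e j : psum [seq lform be | be <- mnms n e] j.+1 \is symmetric.
Proof.
apply: newton_rec_p_sym (newton_esym _) _ j; first exact: coef_esym_poly0.
by move=> k; rewrite -chern_esym chern_sym.
Qed.

(** Each [psum] over degree [e] is symmetric because the Chern classes are; the restricted power
    sums combine these, and Newton's recurrence carries symmetry back. *)
Lemma rlforms_sym d k : (esym_poly (rlforms d))`_k \is symmetric.
Proof.
apply: newton_rec_c_sym (newton_esym _) _ k; first exact: coef_esym_poly0.
move=> j; rewrite psum_rlforms; apply: rpred_sum => e _.
by rewrite rpredMn ?psum_sym.
Qed.

End Restriction.

(** * Coefficients in the elementary basis as coefficients of [symf] *)

Definition multnm n (la : seq nat) : 'X_{1..n} :=
  [multinom count_mem i.+1 la | i < n].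

Lemma mdeg_multnm k n la : (k <= n)%N -> is_partn k la ->
  mdeg (multnm n la) = size la.
Proof.
move=> le_kn hla; rewrite -[size la]sum1_size (big_partn le_kn _ _ hla) mdegE.
by apply: eq_bigr => i _; rewrite mnmE Monoid.iteropE iter_addn_0 mul1n.
Qed.

(** In the variables [y_i] that stand for [e_(i+1)], [e_la] is the monomial with exponent
    [multnm n la]; algebraic independence identifies the two expansions. *)
Lemma mesym_coef_symf k n la (p : {mpoly rat[n]}) :
  (k <= n)%N -> p \is symmetric -> p \is k.-homog -> is_partn k la ->
  mesym_coef k la p = (symf p)@_(multnm n la).
Proof.
move=> le_kn sp hp hla; pose a mu := mesym_coef k mu p.
have -> : symf p = \sum_(mu : k.-bseq 'I_k.+1 | is_partn k (map val mu))
    a (map val mu) *: 'X_[multnm n (map val mu)].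
  apply: msym_fundamental_un; rewrite -symfP // linear_sum /=.
  rewrite {1}(mesym_coefP le_kn sp hp); apply: eq_bigr => mu hmu.
  by rewrite linearZ /= (mesym_prodE le_kn hmu).
have [mu emu] := partn_bseq hla.
rewrite linear_sum (bigD1 mu) /= ?emu // mcoeffZ mcoeffX eqxx mulr1.
rewrite big1 ?addr0 // => nu /andP[hnu ne].
rewrite mcoeffZ mcoeffX; case: eqP; rewrite ?mulr0 // => e.
case/eqP: ne; apply/val_inj/(inj_map val_inj).
by rewrite /= emu (mult_inj le_kn hnu hla e).
Qed.

(** * Coefficientwise limits under rescaling of the variables *)

Section WeightedAsymptotics.

Variables K D : nat.
Implicit Types (F G : nat -> {mpoly rat[K]}) (A B : {mpoly rat[K]}).

(* [A] is the limit of [F m] after rescaling every variable by [(K + m)^D]. *)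
Definition asyp F A := forall u : 'X_{1..K},
  asy K (D * mdeg u) A@_u (fun m => (F m)@_u).

Lemma eq_asyp F G A B : A = B -> F =1 G -> asyp F A -> asyp G B.
Proof. by move=> <- fg h u; apply: eq_asy (h u) => // m; rewrite fg. Qed.

Lemma asyp1 : asyp (fun=> 1) 1.
Proof.
move=> u; rewrite mcoeff1; case: eqP => [->|_]; last exact: asy0.
by rewrite mdeg0 muln0; apply: asy_cst.
Qed.

Lemma asypZ b F A : asyp F A -> asyp (fun m => b *: F m) (b *: A).
Proof.
move=> h u; rewrite mcoeffZ.
by apply: eq_asy (asyZ b (h u)) => // m; rewrite mcoeffZ.
Qed.

Lemma asyp_sum (I : Type) (r : seq I) (P : pred I) (F : I -> nat -> {mpoly rat[K]})
    (A : I -> {mpoly rat[K]}) :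
  (forall i, P i -> asyp (F i) (A i)) ->
  asyp (fun m => \sum_(i <- r | P i) F i m) (\sum_(i <- r | P i) A i).
Proof.
move=> h u; rewrite linear_sum /=.
apply: eq_asy (asy_sum r (fun i Pi => h i Pi u)) => // m.
by rewrite linear_sum.
Qed.

(** The order [D * mdeg u] is additive in [u], so every term of the convolution has the same
    order. *)
Lemma asypM F G A B : asyp F A -> asyp G B ->
  asyp (fun m => F m * G m) (A * B).
Proof.
move=> hF hG u; rewrite mcoeffM.
apply: eq_asy (asy_sum _ _) => [//|m|v /eqP e]; first by rewrite mcoeffM.
have -> : (D * mdeg u = D * mdeg v.1 + D * mdeg v.2)%N.
  by rewrite -mulnDr -mdegD -e.
exact: asyM.
Qed.

End WeightedAsymptotics.

(** * Auxiliary facts on coefficients *)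

Section Monomials.

Variables (n : nat) (R : comNzRingType).
Implicit Types (p : {mpoly R[n]}) (u : 'X_{1..n}).

Lemma mcoeffMXU p (i : 'I_n) u :
  (p * 'X_i)@_u = if u i == 0%N then 0 else p@_(u - U_(i))%MM.
Proof.
case: eqP => [ui0|/eqP ui0]; last first.
  have {1}<- : (U_(i) + (u - U_(i)) = u)%MM; last by rewrite mcoeffMX.
  rewrite addmC submK //; apply/mnm_lepP => j; rewrite mnm1E.
  by case: eqP => // <-; rewrite lt0n.
apply/eqP; rewrite mcoeff_eq0 (perm_mem (msuppMX p _)).
apply/mapP => -[v _ e]; move: ui0.
by rewrite e mnmDE mnm1E eqxx.
Qed.

Lemma wgt_homog_mcoeff0 p k : p \is k.+1.-homog for (@mnmwgt n) -> p@_0%MM = 0.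
Proof. by move=> hp; apply: (dhomog_nemf_coeff hp); rewrite /= mnmwgt0. Qed.

End Monomials.

(** * The limit polynomial and its recurrence *)

Section Leading.

Variables (K : nat) (kappa : rat).

Definition expcoef (u : 'X_{1..K}) : rat :=
  kappa ^+ mdeg u / (\prod_(i < K) (u i)`!)%:R.

(* The weight [k] part of the exponential of [kappa (y_1 + ... + y_K)]. *)
Definition lead k : {mpoly rat[K]} :=
  \sum_(u : 'X_{1..K < k.+1} | mnmwgt u == k) expcoef u *: 'X_[u].

Lemma mcoeff_lead k u :
  (lead k)@_u = if mnmwgt u == k then expcoef u else 0.
Proof.
rewrite /lead linear_sum /=; case: eqP => [wu|wu].
  have lt_u : (mdeg u < k.+1)%N by rewrite ltnS -wu leq_mdeg_mnmwgt.
  rewrite (bigD1 (BMultinom lt_u)) /= ?wu // mcoeffZ mcoeffX eqxx mulr1.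
  rewrite big1 ?addr0 // => v /andP[_ ne]; rewrite mcoeffZ mcoeffX.
  case: eqP; rewrite ?mulr0 // => e; case/eqP: ne; exact: val_inj.
rewrite big1 // => v /eqP wv; rewrite mcoeffZ mcoeffX.
by case: eqP; rewrite ?mulr0 // => e; case: wu; rewrite -e.
Qed.

Lemma lead0 : lead 0 = 1.
Proof.
apply/mpolyP => u; rewrite mcoeff_lead mcoeff1.
have -> : (mnmwgt u == 0%N) = (u == 0%MM).
  apply/idP/eqP => [wu|->]; last by rewrite mnmwgt0.
  by apply/eqP; rewrite -mdeg_eq0 -leqn0 (leq_trans (leq_mdeg_mnmwgt _)) ?leqn0.
case: eqP => // ->; rewrite /expcoef mdeg0 expr0 big1 ?divr1 // => i _.
by rewrite mnm0E.
Qed.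

(** The coefficient form of: the derivative of the exponential in [y_i] is [kappa] times itself. *)
Lemma expcoef_sub (u : 'X_{1..K}) i : u i != 0%N ->
  kappa * expcoef (u - U_(i))%MM = (u i)%:R * expcoef u.
Proof.
move=> ui0; set v := (u - U_(i))%MM.
have -> : u = (v + U_(i))%MM.
  rewrite submK //; apply/mnm_lepP => j; rewrite mnm1E.
  by case: eqP => // <-; rewrite lt0n.
rewrite /expcoef mdegD mdeg1 mnmDE mnm1E eqxx !addn1 exprS.
have -> : (\prod_(j < K) ((v + U_(i))%MM j)`! = (v i).+1 * \prod_(j < K) (v j)`!)%N.
  rewrite (bigD1 i) // [in RHS](bigD1 i) //= mnmDE mnm1E eqxx addn1 factS mulnA.
  congr (_ * _)%N; apply: eq_bigr => j ne_ji.
  by rewrite mnmDE mnm1E eq_sym (negbTE ne_ji) addn0.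
by rewrite natrM invfM [RHS]mulrCA mulVKf ?mulrA ?pnatr_eq0.
Qed.

(** Weighted Euler identity: the operator summing [(j+1) y_j d/dy_j] acts as [k.+1] on weight
    [k.+1], while each [d/dy_j] multiplies the exponential by [kappa]. *)
Lemma lead_rec k : (k < K)%N ->
  k.+1%:R *: lead k.+1 =
  \sum_(j < K | (j < k.+1)%N) (j.+1%:R * kappa) *: (lead (k - j) * 'X_j).
Proof.
move=> lt_kK; apply/mpolyP => u; rewrite mcoeffZ mcoeff_lead linear_sum /=.
have term (j : 'I_K) : (j < k.+1)%N ->
    ((j.+1%:R * kappa) *: (lead (k - j) * 'X_j))@_u =
    if mnmwgt u == k.+1 then (u j * j.+1)%:R * expcoef u else 0.
  rewrite ltnS => le_jk; rewrite mcoeffZ mcoeffMXU; case: eqP => [->|/eqP uj].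
    by rewrite mul0n mul0r mulr0 if_same.
  rewrite mcoeff_lead; have le_u : (U_(j) <= u)%MM.
    apply/mnm_lepP => i; rewrite mnm1E.
    by case: eqP => // <-; rewrite lt0n.
  have -> : (mnmwgt (u - U_(j))%MM == (k - j)%N) = (mnmwgt u == k.+1).
    rewrite -{2}(submK le_u) mnmwgtD mnmwgt1 -{2}(subnK le_jk) -addnS.
    by rewrite eqn_add2r.
  case: eqP; last by rewrite mulr0.
  by rewrite -mulrA expcoef_sub // natrM mulrCA mulrA.
rewrite (eq_bigr _ term); case: eqP => [wu|_]; last first.
  by rewrite mulr0 big1.
rewrite -mulr_suml -natr_sum -{1}wu /mnmwgt; congr (_%:R * _).
rewrite [in RHS]big_mkcond; apply: eq_bigr => j _; case: ltnP => // le_kj.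
(* A variable [y_j] with [j > k] cannot divide a monomial of weight [k.+1]. *)
have : (u j * j.+1 <= k.+1)%N by rewrite -wu /mnmwgt (bigD1 j) // leq_addr.
by case: (u j) => // v; rewrite mulSn leqNgt ltnS (leq_trans le_kj) ?leq_addr.
Qed.

End Leading.

Lemma mpoly_signZ n (p : {mpoly rat[n]}) j : (-1) ^+ j *: p = (-1) ^+ j * p.
Proof. by rewrite -signr_odd -[in RHS]signr_odd mulr_sign scaler_sign. Qed.

(** * Power sums of linear forms, written in the [y_i] *)

Section PowerSums.

Variable K : nat.

Local Notation S := [tuple mesym K rat i.+1 | i < K].

Definition esymf_psum e j : {mpoly rat[K]} :=
  symf (psum [seq lform be | be <- mnms K e] j).

Lemma esymf_psumP e j :
  esymf_psum e j.+1 \mPo S = psum [seq lform be | be <- mnms K e] j.+1.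
Proof. by rewrite -symfP ?psum_sym. Qed.

Lemma psum_homog n e j :
  psum [seq lform be | be <- mnms n e] j \is j.-homog.
Proof.
rewrite /psum big_map; apply: rpred_sum => be _.
by have := dhomogMn j (dhomog_lform be); rewrite mul1n.
Qed.

Lemma esymf_psum_coef0 e j : (esymf_psum e j.+1)@_0%MM = 0.
Proof.
by apply: (@wgt_homog_mcoeff0 _ _ _ j); rewrite mwmwgt_homogE esymf_psumP psum_homog.
Qed.

Lemma coef_esym_poly_mnms1 k :
  (esym_poly [seq lform be | be <- mnms K 1])`_k = mesym K rat k.
Proof. by rewrite -chern_esym chern1. Qed.

(* Newton's identity for the e_k, read at y_i: the products with a factor e_l,
   l > 0, have no linear part. *)
Lemma esymf_psum_coef1 (i j : 'I_K) :
  (esymf_psum 1 j.+1)@_U_(i) = if i == j then (-1) ^+ j * j.+1%:R else 0.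
Proof.
(* [E k] is [y_k], with default 0 out of range, so that no bound has to be carried in the sum; the
   indices [j - l.+1] stay below [K]. *)
pose E k := if insub k is Some l then 'X_l else 0 : {mpoly rat[K]}.
have compE k : (k < K)%N -> E k \mPo S = mesym K rat k.+1.
  by move=> lt_k; rewrite /E insubT comp_mpolyXU -tnth_nth tnth_mktuple.
have newton : j.+1%:R * 'X_j = \sum_(l < j) (-1) ^+ l * esymf_psum 1 l.+1 * E (j - l.+1)%N
    + (-1) ^+ j * esymf_psum 1 j.+1.
  apply: msym_fundamental_un; rewrite rmorphM rmorph_nat /= comp_mpolyXU -tnth_nth tnth_mktuple.
  have := newton_esym [seq lform be | be <- mnms K 1] j.
  rewrite coef_esym_poly_mnms1 => ->; rewrite big_ord_recr /= subnn.
  rewrite coef_esym_poly0 mulr1 rmorphD rmorphM rmorph_sign /= esymf_psumP.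
  congr (_ + _); rewrite rmorph_sum; apply: eq_bigr => l _.
  rewrite !rmorphM rmorph_sign /= esymf_psumP coef_esym_poly_mnms1 compE.
    by rewrite -subSn.
  by rewrite (leq_ltn_trans (leq_subr _ _)).
have := congr1 (mcoeff U_(i)) newton.
rewrite mcoeffD linear_sum big1 /= => [|l _].
  rewrite add0r !mulr_natl.
  rewrite -mpoly_signZ mcoeffMn mcoeffZ mcoeffX => /(congr1 ( *%R ((-1) ^+ j))).
  rewrite signrMK => <-.
  rewrite eq_mnm1 eq_sym; case: eqP => _; last by rewrite mul0rn mulr0.
  by rewrite -mulr_natr mul1r.
rewrite /E; case: insubP => [l' _ _|_]; last by rewrite mulr0 mcoeff0.
rewrite mcoeffMXU; case: eqP => //; rewrite mnm1E => /eqP.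
rewrite eqb0 negbK => /eqP ->.
have -> : (U_(l') - U_(l') = 0 :> 'X_{1..K})%MM.
  by apply/mnmP => h; rewrite mnmBE subnn mnm0E.
by rewrite rmorphM /= esymf_psum_coef0 mulr0.
Qed.

End PowerSums.

(** * Passing to the limit in Newton's identity, with [D = d - 1] *)

Section ChernAsymptotics.

Variables K D : nat.
Hypothesis D_gt0 : (0 < D)%N.

Local Notation S := [tuple mesym K rat i.+1 | i < K].

Definition esymf_chern k m : {mpoly rat[K]} :=
  symf (esym_poly (rlforms K m D.+1))`_k.

Lemma esymf_chernP k m :
  esymf_chern k m \mPo S = (esym_poly (rlforms K m D.+1))`_k.
Proof. by rewrite -symfP ?rlforms_sym. Qed.

(** Degree 0 in the first [K] variables has zero power sum, so degrees start at [e.+1], leaving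
    degree [D - e] to the other [m]. *)
Definition esymf_rpsum j m : {mpoly rat[K]} :=
  \sum_(e < D.+1) (size (mnms m (D - e)))%:R *: esymf_psum K e.+1 j.

Lemma esymf_rpsumP j m :
  esymf_rpsum j.+1 m \mPo S = psum (rlforms K m D.+1) j.+1.
Proof.
rewrite psum_rlforms big_ord_recl psum_deg0 mul0rn add0r linear_sum.
apply: eq_bigr => e _.
by rewrite lift0 subSS linearZ /= esymf_psumP scaler_nat.
Qed.

Lemma newton_esymf_chern k m :
  k.+1%:R *: esymf_chern k.+1 m =
  \sum_(j < k.+1) (-1) ^+ j *: (esymf_rpsum j.+1 m * esymf_chern (k - j) m).
Proof.
apply: msym_fundamental_un; rewrite linearZ /= esymf_chernP scaler_nat.
have := newton_esym (rlforms K m D.+1) k; rewrite mulr_natl => ->.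
rewrite linear_sum /=; apply: eq_bigr => j _.
rewrite linearZ /= rmorphM /= esymf_rpsumP esymf_chernP -mulrA.
by rewrite -mpoly_signZ.
Qed.

Lemma asy_size_mnms e :
  asy K e e`!%:R^-1 (fun m => (size (mnms m e))%:R).
Proof.
have [C [N h]] := asy_bin K e; exists C, (maxn N 1) => m.
by rewrite geq_max => /andP[/h {}h m_gt0]; rewrite size_mnms.
Qed.

Lemma asyp_esymf_rpsum (j : 'I_K) :
  asyp D (esymf_rpsum j.+1)
    (((-1) ^+ j * (j.+1%:R * D`!%:R^-1)) *: 'X_j).
Proof.
move=> u; rewrite mcoeffZ mcoeffX.
have coefE m : (esymf_rpsum j.+1 m)@_u =
    \sum_(e < D.+1) (esymf_psum K e.+1 j.+1)@_u * (size (mnms m (D - e)))%:R.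
  by rewrite linear_sum; apply: eq_bigr => e _; rewrite /= mcoeffZ mulrC.
have [u1|u1|u1] := ltngtP (mdeg u) 1.
- have -> : u = 0%MM by apply/eqP; rewrite -mdeg_eq0 -leqn0 -ltnS.
  rewrite mnm1_eq0 mulr0; apply: eq_asy (asy0 _ _) => // m.
  rewrite linear_sum big1 // => e _ /=.
  by rewrite mcoeffZ esymf_psum_coef0 mulr0.
- have -> : (U_(j)%MM == u) = false by apply/eqP => e; rewrite -e mdeg1 in u1.
  rewrite mulr0.
  apply: eq_asy (asy_sum (a := fun=> 0) _ _) => [|m|e _].
  + by rewrite big1.
  + by rewrite coefE.
  + rewrite -(mulr0 (esymf_psum K e.+1 j.+1)@_u); apply: asyZ.
    apply: asy_lt (asy_size_mnms _).
    (* In degree at least 2 the growth is too slow: [D - e <= D < D * mdeg u], as [D > 0]. *)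
    by rewrite (leq_ltn_trans (leq_subr _ _)) // -{1}[D]muln1 ltn_pmul2l.
- move/eqP: u1; rewrite mdeg_eq1 => /existsP[i /eqP ->].
  rewrite mdeg1 muln1 eq_mnm1.
  (* In degree 1 only [e = 0] reaches the order [D], with factor [1 / D!] from the count of
     monomials. *)
  apply: eq_asy (asy_sum
    (a := fun e : 'I_D.+1 => if e == ord0 then
       (esymf_psum K 1 j.+1)@_U_(i) * D`!%:R^-1 else 0) (P := xpredT)
    (index_enum _) _) => [|m|e _].
  + rewrite -big_mkcond /= big_pred1_eq esymf_psum_coef1 eq_sym.
    by case: eqP; rewrite ?mulr1 ?mulr0 ?mul0r // -mulrA.
  + by rewrite linear_sum; apply: eq_bigr => e _; rewrite /= mcoeffZ mulrC.
  + case: eqP => [->|/eqP ne_e].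
      by rewrite subn0; apply: asyZ; apply: asy_size_mnms.
    rewrite -(mulr0 (esymf_psum K e.+1 j.+1)@_U_(i)); apply: asyZ.
    apply: asy_lt (asy_size_mnms _).
    by rewrite ltn_subrL D_gt0 andbT lt0n.
Qed.

(** Strong induction: Newton's identity divided by [k.+1] tends to [lead_rec], where the two signs
    [(-1) ^+ j] cancel. *)
Lemma asyp_esymf_chern k : (k <= K)%N ->
  asyp D (esymf_chern k) (lead K D`!%:R^-1 k).
Proof.
elim/ltn_ind: k => -[_ _|k ih lt_kK].
  rewrite lead0; apply: eq_asyp (asyp1 D) => [//|m].
  apply: msym_fundamental_un.
  by rewrite esymf_chernP coef_esym_poly0 rmorph1.
have nz : k.+1%:R != 0 :> rat by rewrite pnatr_eq0.
(* The sum is indexed by the variables and cut at [j < k.+1], as in [lead_rec]; [k < K] makes this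
   the whole range. *)
have sum_asyp := asyp_sum (index_enum 'I_K) (fun (j : 'I_K) (lt_j : (j < k.+1)%N) =>
  asypZ ((-1) ^+ j) (asypM (asyp_esymf_rpsum j)
    (ih (k - j)%N (leq_subr j k) (leq_trans (leq_subr j k) (ltnW lt_kK))))).
apply: eq_asyp (asypZ k.+1%:R^-1 sum_asyp) => [|m].
  apply: (can_inj (scalerK nz)); rewrite (scalerKV nz) lead_rec //.
  apply: eq_bigr => j _.
  by rewrite -scalerAl scalerA signrMK ['X_j * _]mulrC.
apply: (can_inj (scalerK nz)); rewrite (scalerKV nz) newton_esymf_chern.
by rewrite (big_ord_widen K (fun j => (-1) ^+ j *: (esymf_rpsum j.+1 m * esymf_chern (k - j) m))).
Qed.

End ChernAsymptotics.

(** * Final bound and the case [d = 1] *)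

Lemma asy_int_bound K e a f (g : nat -> rat) : asy K e a f ->
  (forall m, g (K + m)%N = f m) ->
  exists (C : rat) (N : nat), forall n : nat, (N <= n)%N ->
    `|g n - a * n%:R ^+ e| <= C * n%:R ^ (e%:Z - 1).
Proof.
move=> /asyP[C [N h]] gf; exists C, (K + N)%N => n le_n.
have le_Kn : (K <= n)%N := leq_trans (leq_addr _ _) le_n.
have le_m : (N <= n - K)%N by rewrite leq_subRL.
have [_ n1 {}h] := h _ le_m; move: n1 h; rewrite -gf subnKC // => n1 h.
have n0 : 0 < n%:R :> rat by apply: lt_le_trans n1.
(* Dividing by [n > 0] gives the exponent [e - 1], an integer power because it is -1 when
   [e = 0]. *)
rewrite expfzDr ?gt_eqF // exprN1 mulrA ler_pdivlMr // mulrC.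
exact: h.
Qed.

Lemma mesym_coef_chern1 k n la : (k <= n)%N -> is_partn k la ->
  (size la <= 1)%N -> mesym_coef k la (chern k n 1) = 1.
Proof.
move=> le_kn hla la1; rewrite chern1.
have prod_la : mesym_prod n la = mesym n rat k.
  have /and3P[_ _ /eqP <-] := hla; rewrite /mesym_prod.
  case: la la1 {hla} => [|i [|//]] _; first by rewrite big_nil mesym0E.
  by rewrite big_seq1 /= addn0.
rewrite (@mesym_coef_uniq _ _ le_kn _ (fun mu => (mu == la)%:R)) ?eqxx //.
have [mu emu] := partn_bseq hla; rewrite /mesym_expansion.
rewrite (bigD1 mu) /= ?emu // eqxx scale1r prod_la big1 ?addr0 //.
move=> nu /andP[_ ne]; case: eqP; rewrite ?scale0r // => e.
by case/eqP: ne; apply/val_inj/(inj_map val_inj); rewrite /= e emu.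
Qed.

Theorem mainTheorem4 (d k : nat) (la : seq nat)
  (d_gt0 : (0 < d)%N)
  (la_partn : is_partn k la)
  (d1_la : d = 1%N -> (size la <= 1)%N) :
  exists (C : rat) (N : nat), forall n : nat, (N <= n)%N ->
    `| mesym_coef k la (chern k n d)
       - ((\prod_(1 <= i < k.+1) (count_mem i la)`!)%:R
          * (d.-1)`!%:R ^+ size la)^-1
         * n%:R ^+ (d.-1 * size la) |
    <= C * n%:R ^ ((d.-1 * size la)%:Z - 1).
Proof.
case: d d_gt0 d1_la => [//|[_ d1_la|D _ _]].
  (* For [d = 1] the coefficient is exactly 1, and with at most one part all factorials are 1: the
     error is 0. *)
  have la1 := d1_la erefl; exists 0, k => n le_kn; rewrite mul0r /= mul0n.
  rewrite (mesym_coef_chern1 le_kn la_partn la1) big1 => [|i _].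
    by rewrite fact0 !mulr1n expr1n expr0 !mulr1 invr1 subrr normr0.
  suff : (count_mem i la <= 1)%N by case: (count_mem i la) => [|[]].
  exact: leq_trans (count_size _ _) la1.
(* Here [d = D.+2], so the scale is [D.+1 = d - 1]; [K = k] variables suffice, read at the exponent
   of [e_la]. *)
have := asyp_esymf_chern (ltn0Sn D) (leqnn k) (multnm k la).
have wgt_la : mnmwgt (multnm k la) = k := mnmwgt_mult (leqnn k) la_partn.
rewrite mcoeff_lead wgt_la eqxx (mdeg_multnm (leqnn k) la_partn).
move=> /asy_int_bound h.
have coefE m :
    mesym_coef k la (chern k (k + m) D.+2) = (esymf_chern k D.+1 k m)@_(multnm k la).
  rewrite mesym_coef_restr // (mesym_coef_symf (leqnn k)) //.
    exact: rlforms_sym.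
  exact: rlforms_homog.
have [C [N {}h]] := h (fun n => mesym_coef k la (chern k n D.+2)) coefE.
exists C, N; suff -> : (\prod_(1 <= i < k.+1) (count_mem i la)`!)%:R
    * D.+1`!%:R ^+ size la = (expcoef D.+1`!%:R^-1 (multnm k la))^-1 :> rat.
  by rewrite invrK.
rewrite /expcoef (mdeg_multnm (leqnn k) la_partn) exprVn invfM invrK invrK.
(* The part [i] corresponds to the variable of index [i - 1]. *)
rewrite mulrC big_add1 big_mkord; congr (_ * _%:R).
by apply: eq_bigr => i _; rewrite mnmE.
Qed.
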